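(* For every integer $n\ge 5$, $diss(K_{n,2})=\max\{n-1,6\}$.
   Context: For positive integers $n,k$ with $n\ge 2k$, the Kneser graph $K_{n,k}$ has as vertices all $k$-element subsets of $[n]=\{1,\dots,n\}$, two of them being adjacent if and only if they are disjoint. A set $D$ of vertices of a graph $G$ is a dissociation set if the subgraph of $G$ induced by $D$ has maximum degree at most $1$. The dissociation number $diss(G)$ is the maximum cardinality of a dissociation set in $G$. *)

(* Defs.v *)
From mathcomp Require Import all_boot.

Set Implicit Arguments.
Unset Strict Implicit.
Unset Printing Implicit Defensive.

(* A graph is given by its adjacency relation on a finite vertex type. *)
Section Dissociation.
Variables (T : finType) (e : rel T).

Definition induced_degree (D : {set T}) (x : T) : nat :=
  #|[set y in D | e x y]|.

Definition induced_max_degree (D : {set T}) : nat :=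
  \max_(x in D) induced_degree D x.

Definition dissociation_set (D : {set T}) : bool :=
  induced_max_degree D <= 1.

(* The empty set is a dissociation set, so this is a genuine maximum. *)
Definition diss : nat := \max_(D : {set T} | dissociation_set D) #|D|.

End Dissociation.

(* The ground set [n] is represented by 'I_n = {0, ..., n-1}. *)
Definition kneser_vertex (n k : nat) : finType :=
  {A : {set 'I_n} | #|A| == k}.

(* For k > 0 this relation is irreflexive; for k = 0 the only vertex, set0,
   would be adjacent to itself. *)
Definition kneser (n k : nat) : rel (kneser_vertex n k) :=
  fun A B => [disjoint val A & val B].

(* Main.v *)
Require Import Defs.
From mathcomp Require Import all_boot.

(** View a set of vertices of the Kneser graph $K_{n,2}$ as the edge set of a
    graph on $[n]$; adjacency of vertices is then disjointness of edges.

    For the lower bound there are two constructions. The $n-1$ edges through a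
    fixed point pairwise meet, so they are independent; the six edges inside
    a set of four points form a perfect matching of $K_{n,2}$, since there the
    only edge disjoint from a given one is its complement.

    For the upper bound, let $D$ be a dissociation set. If $D$ contains two
    disjoint edges $A$ and $B$, each already has its one permitted neighbour,
    so every other edge of $D$ meets both and thus lies inside the four-point
    set $A \cup B$; hence $|D| \le 6$. Otherwise the edges pairwise meet, and
    they form a star or a triangle. So every dissociation set lies inside a star
    or inside a set of at most four points ([dissociation_star_or_small]), and
    these two kinds of families are counted by [card_star] and
    [card_pairs_in]. *)

Lemma dissociation_setP (T : finType) (e : rel T) (D : {set T}) :
  reflect (forall x, x \in D -> #|[set y in D | e x y]| <= 1)
          (dissociation_set e D).
Proof. exact: bigmax_leqP. Qed.

Section PairFamilies.
Set Implicit Arguments.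
Unset Strict Implicit.
Variable n : nat.
Implicit Types (S A B C : {set 'I_n}) (x : 'I_n).

Local Notation vertex := (kneser_vertex n 2).
Implicit Types (X Y Z : vertex) (D : {set vertex}).

Definition star x : {set vertex} := [set X : vertex | x \in val X].
Definition pairs_in S : {set vertex} := [set X : vertex | val X \subset S].

Lemma card_vertex X : #|val X| = 2.
Proof. exact/eqP/(valP X). Qed.

Lemma card_vertices (P : pred {set 'I_n}) :
  #|[set X : vertex | P (val X)]| = #|[set A | P A & #|A| == 2]|.
Proof.
rewrite -(card_imset _ val_inj); apply: eq_card => A; rewrite inE.
apply/imsetP/andP => [[X] | [PA A2]]; first by rewrite inE => PX ->; rewrite PX (valP X).
by exists (Sub A A2); rewrite ?inE SubK.
Qed.

Lemma card_pairs_in S : #|pairs_in S| = 'C(#|S|, 2).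
Proof. by rewrite -cards_draws (card_vertices (fun A => A \subset S)). Qed.

(** A pair through [x] is determined by its other point. *)
Lemma card_star x : #|star x| = n - 1.
Proof.
rewrite (card_vertices (fun A => x \in A)).
have <- : #|[set~ x]| = n - 1 by rewrite cardsC1 card_ord subn1.
have inj : {in [set~ x] &, injective (fun y => [set x; y])}.
  move=> y z; rewrite !inE => yx zx /setP/(_ y).
  by rewrite !inE eqxx orbT (negPf yx) => /esym/eqP.
rewrite -(card_in_imset inj); apply: eq_card => A; rewrite inE.
apply/andP/imsetP => [[xA /cards2P[a [b [ab defA]]]] | [y]].
  move: xA; rewrite defA !inE => /orP[]/eqP->.
    by exists b; rewrite // !inE eq_sym.
  by exists a; rewrite ?inE // setUC.
by rewrite !inE => yx ->; rewrite !inE eqxx cards2 eq_sym yx.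
Qed.

Lemma star_dissociation x : dissociation_set (@kneser n 2) (star x).
Proof.
apply/dissociation_setP => X; rewrite inE => xX.
suff -> : [set Y in star x | kneser X Y] = set0 by rewrite cards0.
apply/setP => Y; rewrite !inE; apply/negP => /andP[xY /disjointFr/(_ xX)].
by rewrite xY.
Qed.

(** The only pair inside a four-point set disjoint from a given one is its
    complement there. *)
Lemma pairs_in_dissociation S :
  #|S| <= 4 -> dissociation_set (@kneser n 2) (pairs_in S).
Proof.
move=> S4; apply/dissociation_setP => X; rewrite inE => XS.
have compl Y : Y \in [set Y in pairs_in S | kneser X Y] ->
    val Y = S :\: val X.
  rewrite !inE /kneser disjoint_sym => /andP[YS YX].
  apply/eqP; rewrite eqEcard subsetD YS YX /=.
  by rewrite cardsD (setIidPr XS) !card_vertex leq_subLR.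
by apply/card_le1_eqP => Y Z /compl eY /compl eZ; apply: val_inj; rewrite eY eZ.
Qed.

Lemma pair_subset X S x y :
  x != y -> x \in val X -> y \in val X -> x \in S -> y \in S -> val X \subset S.
Proof.
move=> xy xX yX xS yS.
have /eqP <- : [set x; y] == val X.
  by rewrite eqEcard subUset !sub1set xX yX card_vertex cards2 xy.
by rewrite subUset !sub1set xS yS.
Qed.

Lemma pair_meets_disjoint X A B :
  [disjoint A & B] -> ~~ [disjoint val X & A] -> ~~ [disjoint val X & B] ->
  val X \subset A :|: B.
Proof.
move=> dAB /pred0Pn[x /andP[/= xX xA]] /pred0Pn[y /andP[/= yX yB]].
apply: (@pair_subset _ _ x y); rewrite ?inE ?xA ?yB ?orbT //.
by apply/eqP => xy; rewrite -xy (disjointFr dAB xA) in yB.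
Qed.

(** In a nonempty family of pairwise meeting pairs without a common point, any
    pair $\{a,b\}$ comes with a pair avoiding $a$ and a pair avoiding $b$;
    meeting each other and $\{a,b\}$ forces these to be $\{b,c\}$ and $\{a,c\}$,
    and a pair that meets all three sides of a triangle is one of its sides. *)
Lemma intersecting_star_or_triangle D :
  {in D &, forall X Y, ~~ kneser X Y} ->
  (exists x, D \subset star x) \/
  exists2 S : {set 'I_n}, #|S| <= 3 & D \subset pairs_in S.
Proof.
move=> meet.
have [->|[A AD]] := set_0Vmem D.
  by right; exists set0; rewrite ?cards0 ?sub0set.
have [/existsP[x Dx]|/existsPn nostar] := boolP [exists x, D \subset star x].
  by left; exists x.
right; have /cards2P[a [b [ab defA]]] := valP A.
have avoid x : exists2 X, X \in D & x \notin val X.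
  by have /subsetPn[X XD] := nostar x; rewrite inE; exists X.
have [B BD aB] := avoid a; have [C CD bC] := avoid b.
have bB : b \in val B.
  have /pred0Pn[y /andP[/=]] := meet _ _ AD BD.
  by rewrite defA !inE => /orP[]/eqP-> //; rewrite (negPf aB).
have aC : a \in val C.
  have /pred0Pn[y /andP[/=]] := meet _ _ AD CD.
  by rewrite defA !inE => /orP[]/eqP-> //; rewrite (negPf bC).
have /pred0Pn[c /andP[/= cB cC]] := meet _ _ BD CD.
have ac : a != c by apply: contraNneq aB => ->.
have bc : b != c by apply: contraNneq bC => ->.
have BS : val B \subset [set b; c].
  by apply: (pair_subset bc); rewrite // !inE eqxx ?orbT.
have CS : val C \subset [set a; c].
  by apply: (pair_subset ac); rewrite // !inE eqxx ?orbT.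
exists [set a; b; c].
  by rewrite setUC cardsU1 cards2 ab; case: (c \notin _).
apply/subsetP => X XD; rewrite inE.
have /pred0Pn[y /andP[/= yX]] := meet _ _ XD AD.
rewrite defA !inE => /orP[]/eqP ey; rewrite {y}ey in yX.
  have /pred0Pn[z /andP[/= zX /(subsetP BS)]] := meet _ _ XD BD.
  by rewrite !inE => /orP[]/eqP ez; rewrite {z}ez in zX;
     [apply: (pair_subset ab) | apply: (pair_subset ac)];
     rewrite // !inE eqxx ?orbT.
have /pred0Pn[z /andP[/= zX /(subsetP CS)]] := meet _ _ XD CD.
by rewrite !inE => /orP[]/eqP ez; rewrite {z}ez in zX;
   [apply: (pair_subset ab) | apply: (pair_subset bc)];
   rewrite // !inE eqxx ?orbT.
Qed.

Lemma dissociation_star_or_small D :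
  dissociation_set (@kneser n 2) D ->
  (exists x, D \subset star x) \/
  exists2 S : {set 'I_n}, #|S| <= 4 & D \subset pairs_in S.
Proof.
move=> /dissociation_setP degD.
have uniq_nbr X Y Z : X \in D -> Y \in D -> Z \in D ->
    kneser X Y -> kneser X Z -> Y = Z.
  move=> XD YD ZD XY XZ.
  by apply: (card_le1_eqP (degD X XD)); rewrite inE ?YD ?ZD.
have [/existsP[A /existsP[B /and3P[AD BD dAB]]]|nodisj] :=
  boolP [exists A, exists B, [&& A \in D, B \in D & kneser A B]].
  right; exists (val A :|: val B).
    by rewrite (leq_trans (leq_card_setU _ _)) // !card_vertex.
  apply/subsetP => X XD; rewrite inE.
  have [->|XA] := eqVneq X A; first exact: subsetUl.
  have [->|XB] := eqVneq X B; first exact: subsetUr.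
  apply: pair_meets_disjoint => //.
    by apply: contra XB; rewrite disjoint_sym => AX; apply/eqP/(uniq_nbr A).
  apply: contra XA; rewrite disjoint_sym => BX; apply/eqP/(uniq_nbr B) => //.
  by rewrite /kneser disjoint_sym.
case: (@intersecting_star_or_triangle D) => [A B AD BD||[S S3 DS]].
- by move/existsPn/(_ A)/existsPn/(_ B): nodisj; rewrite AD BD.
- by left.
- by right; exists S => //; apply: leq_trans S3 _.
Qed.

End PairFamilies.

Theorem proposition2p1 (n : nat) (hn : 5 <= n) :
  diss (@kneser n 2) = maxn (n - 1) 6.
Proof.
apply/eqP; rewrite eqn_leq geq_max; apply/and3P; split.
- apply/bigmax_leqP => D /dissociation_star_or_small[[x Dx]|[S S4 DS]].
    by rewrite leq_max -(card_star x) (subset_leq_card Dx).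
  rewrite leq_max; apply/orP; right; apply: leq_trans (subset_leq_card DS) _.
  by rewrite card_pairs_in; apply: leq_trans (leq_bin2l 2 S4) _.
- have x : 'I_n by apply: Ordinal hn.
  rewrite -(card_star x).
  exact: leq_bigmax_cond (star_dissociation x).
- have [S cardS] : exists S : {set 'I_n}, #|S| = 4.
    have := cards_draws [set: 'I_n] 4; rewrite cardsT card_ord => draws.
    have /card_gt0P[S] : 0 < #|[set S : {set 'I_n} | S \subset setT & #|S| == 4]|.
      by rewrite draws bin_gt0 ltnW.
    by rewrite inE => /andP[_ /eqP]; exists S.
  rewrite -[6]/('C(4, 2)) -cardS -card_pairs_in.
  by apply: leq_bigmax_cond; apply: pairs_in_dissociation; rewrite cardS.
Qed.
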